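(* Let $A$ be a $C^*$-algebra and let $I \subseteq A$ be a proper, not necessarily closed, ideal, that is, $I \neq A$. Then there exists a prime ideal $J \subseteq A$ such that $I \subseteq J$.
   Context: $C^*$-algebras are not assumed to be unital. An ideal in a $C^*$-algebra means a two-sided ideal that is not necessarily closed. An ideal $I$ in a ring $R$ is prime if $I \neq R$ and whenever $J, K \subseteq R$ are ideals with $JK \subseteq I$, then $J \subseteq I$ or $K \subseteq I$. Prime ideals are not required to be closed. *)

(* Defs.v *)
From HB Require Import structures.
From mathcomp Require Import all_boot all_order all_algebra.
From mathcomp Require Import complex.
From mathcomp Require Import all_classical all_reals all_analysis.

Set Implicit Arguments.
Unset Strict Implicit.
Unset Printing Implicit Defensive.

Import Order.TTheory GRing.Theory Num.Theory.
Import numFieldNormedType.Exports.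
Local Open Scope classical_set_scope.
Local Open Scope ring_scope.

(** C*-algebras over the complex numbers R[i], R : realType. They need not be
    unital, so the product cannot come from the ring structures of MathComp,
    which all have a 1; it is an operation on the underlying Banach space. The
    norm takes its values in R[i], where the order relation forces it to be
    real and nonnegative. *)
HB.mixin Record BanachSpace_isCstarAlgebra (R : realType) A
    of CompleteNormedModule R[i] A := {
  cmul : A -> A -> A ;
  cadj : A -> A ;
  cmulA : associative cmul ;
  cmulDl : left_distributive cmul +%R ;
  cmulDr : right_distributive cmul +%R ;
  cmulZl : forall (a : R[i]) (x y : A), cmul (a *: x) y = a *: cmul x y ;
  cmulZr : forall (a : R[i]) (x y : A), cmul x (a *: y) = a *: cmul x y ;
  cadjK : involutive cadj ;
  cadjD : {morph cadj : x y / x + y} ;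
  cadjZ : forall (a : R[i]) (x : A), cadj (a *: x) = a^*%R *: cadj x ;
  cadjM : forall x y : A, cadj (cmul x y) = cmul (cadj y) (cadj x) ;
  cnormM : forall x y : A, `|cmul x y| <= `|x| * `|y| ;
  cnormC : forall x : A, `|cmul (cadj x) x| = `|x| ^+ 2
}.

#[short(type="cstarAlgType")]
HB.structure Definition CstarAlgebra (R : realType) :=
  { A of BanachSpace_isCstarAlgebra R A & CompleteNormedModule R[i] A }.

Declare Scope cstar_scope.
Delimit Scope cstar_scope with cstar.
Notation "x ** y" := (cmul x y) (at level 40, left associativity) : cstar_scope.
Local Open Scope cstar_scope.

(** Ideals are taken in the sense of ring theory. Closure under scalar
    multiplication is not required, and need not follow when A has no unit;
    for prime ideals it does follow, see [prime_ideal_scale]. *)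
Record is_ideal (R : realType) (A : cstarAlgType R) (I : set A) : Prop := {
  ideal0 : I 0 ;
  idealB : forall x y, I x -> I y -> I (x - y) ;
  idealMl : forall a x, I x -> I (a ** x) ;
  idealMr : forall a x, I x -> I (x ** a)
}.

(** JK is the set of finite sums of products, not just of products. *)
Definition ideal_mul (R : realType) (A : cstarAlgType R) (J K : set A) : set A :=
  [set x | exists (n : nat) (j k : 'I_n -> A),
    [/\ forall i, J (j i), forall i, K (k i) & x = \sum_(i < n) j i ** k i]].

Record is_prime_ideal (R : realType) (A : cstarAlgType R) (I : set A) : Prop := {
  prime_ideal_ideal : is_ideal I ;
  prime_ideal_proper : I <> setT ;
  prime_ideal_prime : forall J K : set A, is_ideal J -> is_ideal K ->
    ideal_mul J K `<=` I -> J `<=` I \/ K `<=` I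
}.

Lemma prime_ideal_scale (R : realType) (A : cstarAlgType R) (I : set A)
    (a : R[i]) (x : A) : is_prime_ideal I -> I x -> I (a *: x).
Proof.
move=> [[I0 IB IMl IMr] _ Iprime] Ix.
have ID u v : I u -> I v -> I (u + v).
  by move=> Iu Iv; rewrite -[v]opprK -[- v]add0r; apply: (IB) => //; apply: (IB).
pose J := [set a *: u | u in I].
have JI : is_ideal J.
  split.
  - by exists 0 => //; rewrite scaler0.
  - by move=> _ _ [u Iu <-] [v Iv <-]; exists (u - v); rewrite ?scalerBr//; apply: (IB).
  - by move=> b _ [u Iu <-]; exists (b ** u); rewrite ?cmulZr//; apply: (IMl).
  - by move=> b _ [u Iu <-]; exists (u ** b); rewrite ?cmulZl//; apply: (IMr).
have JJ : ideal_mul J J `<=` I.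
  move=> _ [n [j [k [Jj Jk ->]]]].
  apply: (big_ind I) => // i _; have [u Iu <-] := Jj i.
  by rewrite cmulZl -cmulZr; apply: (IMr).
by have [] := Iprime J J JI JI JJ; apply; exists x.
Qed.

(* Main.v *)
From Pilot Require Import Defs.
From mathcomp Require Import all_boot all_order all_algebra.
From mathcomp Require Import complex.
From mathcomp Require Import all_classical all_reals all_analysis.
From mathcomp Require Import ring lra zify.

(** By Zorn's lemma an ideal disjoint from [{b^n | n >= 1}] lies in a prime
    ideal, so it is enough to find [b] none of whose powers lies in [I]. A
    scalar multiple of some skew-adjoint [k] is outside [I], and it suffices that
    [k] belongs to [b^n A] for every [n]; think of [b = g(k)] with
    [g(t) = 1 / log(1/|t|)]. Without functional calculus, [b] is obtained as in
    Cohen's factorization theorem: [k] is dissipative by the C*-identity, so the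
    resolvents [(1 + t k)^-1] are contractions and
    [z = t k (1 + t k)^-1] satisfies [z k -> k] as [t -> oo]. Then
    [b = sum_n 2^-(n+1) z_n], with [z_n k -> k] faster than every [2^-(m n)];
    this rate survives division by [b], so that the division can be iterated. *)

Set Implicit Arguments.
Unset Strict Implicit.
Unset Printing Implicit Defensive.

Import Order.TTheory GRing.Theory Num.Theory.
Import numFieldNormedType.Exports.
(* [all_algebra] shadows the field [idealMr] of [is_ideal]. *)
Import Pilot.Defs.
Local Open Scope classical_set_scope.
Local Open Scope complex_scope.
Local Open Scope ring_scope.
Local Open Scope cstar_scope.

(** Replaces most passages to the limit below: two limits are identified by bounding the norm of
    their difference by [D * q ^+ n] for every [n]. *)
Lemma le0_geometric (R : realType) (q D x : R) : 0 <= q -> q < 1 ->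
  (forall n, x <= D * q ^+ n) -> x <= 0.
Proof.
move=> q0 q1 xD.
have /cvgrPdist_lt qn0 : geometric D q @ \oo --> 0.
  by apply: cvg_geometric; rewrite ger0_norm.
rewrite leNgt; apply/negP => x0; have [n _ /(_ n (leqnn n))] := qn0 _ x0.
rewrite /= sub0r normrN => /(le_lt_trans (ler_norm _)).
by rewrite ltNge xD.
Qed.

(** * The norm as a real-valued function *)

Section CstarAlgebraTheory.
Variables (R : realType) (A : cstarAlgType R).
Implicit Types (x y z k b c w : A) (r t e : R).

(* The values of [`|x|] lie in [R[i]], whose order is only partial. *)
Definition rnorm x : R := complex.Re `|x|.

Lemma rnormE x : (rnorm x)%:C = `|x|.
Proof. by rewrite /rnorm RRe_real. Qed.

Lemma rnorm_ge0 x : 0 <= rnorm x.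
Proof. by rewrite -lecR rnormE; exact: normr_ge0. Qed.

Lemma rnormD x y : rnorm (x + y) <= rnorm x + rnorm y.
Proof. by rewrite -lecR rmorphD/= !rnormE; exact: ler_normD. Qed.

Lemma rnormN x : rnorm (- x) = rnorm x.
Proof. by rewrite /rnorm normrN. Qed.

Lemma rnorm_distrC x y : rnorm (x - y) = rnorm (y - x).
Proof. by rewrite -rnormN opprB. Qed.

Lemma rnormB x y : rnorm (x - y) <= rnorm x + rnorm y.
Proof. by rewrite -(rnormN y) rnormD. Qed.

Lemma rnormM x y : rnorm (x ** y) <= rnorm x * rnorm y.
Proof. by rewrite -lecR rmorphM/= !rnormE; exact: cnormM. Qed.

Lemma rnormZ r x : 0 <= r -> rnorm (r%:C *: x) = r * rnorm x.
Proof.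
move=> r0; apply: complexI; rewrite rmorphM/= !rnormE normrZ ger0_norm//.
by rewrite -(rmorph0 (real_complex R)) lecR.
Qed.

Lemma rnorm_eq0 x : rnorm x <= 0 -> x = 0.
Proof.
move=> x0; apply/normr0_eq0; rewrite -rnormE.
by have -> : rnorm x = 0 by apply/le_anti; rewrite x0 rnorm_ge0.
Qed.

Lemma rnorm0 : rnorm (0 : A) = 0.
Proof. by rewrite /rnorm normr0. Qed.

Lemma rnorm_adj_mul x : rnorm (cadj x ** x) = rnorm x ^+ 2.
Proof. by apply: complexI; rewrite rmorphXn/= !rnormE cnormC. Qed.

Lemma rnorm_adj x : rnorm (cadj x) = rnorm x.
Proof.
have le y : rnorm y <= rnorm (cadj y).
  have := rnormM (cadj y) y; rewrite rnorm_adj_mul expr2.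
  by have := rnorm_ge0 y; rewrite le0r => /predU1P[->|y0]; rewrite ?rnorm_ge0// ler_pM2r.
by apply/le_anti; rewrite le andbT -{2}(cadjK x) le.
Qed.

(** * Geometric convergence and contractions *)

Lemma geometric_cvg (u : nat -> A) (q D : R) : 0 <= q -> q < 1 ->
  (forall n, rnorm (u n.+1 - u n) <= D * q ^+ n) ->
  exists l, forall n, rnorm (u n - l) <= D / (1 - q) * q ^+ n.
Proof.
move=> q0 q1 uD.
have q1' : 0 < 1 - q by rewrite subr_gt0.
have D0 : 0 <= D by have := uD 0%N; rewrite expr0 mulr1; apply: le_trans (rnorm_ge0 _).
(* The factor [1 - q ^+ m], exact for a geometric sum, lets the induction on [m] close. *)
have um n m : rnorm (u (n + m)%N - u n) <= D / (1 - q) * q ^+ n * (1 - q ^+ m).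
  elim: m => [|m IH]; first by rewrite addn0 subrr rnorm0 expr0 subrr mulr0.
  rewrite addnS -(subrKA (u (n + m)%N)); apply: le_trans (rnormD _ _) _.
  apply: le_trans (lerD (uD _) IH) _.
  by rewrite le_eqVlt; apply/predU1P; left; rewrite exprD exprS; field; lra.
have uC n m : rnorm (u (n + m)%N - u n) <= D / (1 - q) * q ^+ n.
  apply: le_trans (um _ _) _; rewrite ler_piMr//.
    by rewrite mulr_ge0 ?divr_ge0 ?exprn_ge0// ltW.
  by rewrite gerBl exprn_ge0.
have epsE (e : R[i]) : 0 < e -> exists2 e' : R, 0 < e' & e = e'%:C.
  move=> e0; exists (complex.Re e); last by rewrite RRe_real// gtr0_real.
  by rewrite -ltcR RRe_real// gtr0_real.
have /cvg_ex[l /cvgrPdist_lt ul] : cvgn u.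
  apply: cauchy_cvg; apply: cauchy_exP => e /epsE[{}e e0 ->].
  have [n une] : exists n, D / (1 - q) * q ^+ n < e.
    apply: contrapT => /forallNP nge.
    have : e <= 0.
      apply: (@le0_geometric _ q (D / (1 - q))) => // n.
      by rewrite leNgt; apply/negP/nge.
    by rewrite leNgt e0.
  exists (u n), n => // m /= nm; rewrite -ball_normE/= -rnormE ltcR.
  by rewrite rnorm_distrC -(subnKC nm); apply: le_lt_trans (uC _ _) une.
exists l => n; apply/ler_addgt0Pl => e e0.
have [] := ul e%:C; first by rewrite ltcR.
move=> M _ /(_ (n + M)%N (leq_addl _ _)); rewrite -rnormE ltcR => leM.
rewrite -(subrKA (u (n + M)%N)) addrC; apply: le_trans (rnormD _ _) _.
apply: lerD; first by rewrite rnorm_distrC ltW.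
by rewrite rnorm_distrC.
Qed.

Lemma contraction_fixpoint (f : A -> A) (q : R) : 0 <= q -> q < 1 ->
  (forall x y, rnorm (f x - f y) <= q * rnorm (x - y)) -> exists x, x = f x.
Proof.
move=> q0 q1 fq; pose u n := iter n f 0.
have [|l ul] := @geometric_cvg u q (rnorm (u 1%N - u 0%N)) q0 q1.
  elim=> [|n IH]; first by rewrite expr0 mulr1.
  by apply: le_trans (fq _ _) _; rewrite exprS mulrCA ler_wpM2l.
exists l; apply/subr0_eq/rnorm_eq0.
pose D := rnorm (u 1%N - u 0%N) / (1 - q).
apply: (@le0_geometric _ q (2 * q * D)) => // n.
rewrite -(subrKA (u n.+1)); apply: le_trans (rnormD _ _) _.
have := ul n.+1; rewrite rnorm_distrC => h1.
have /(ler_wpM2l q0) h2 := ul n; have h3 := le_trans (fq _ _) h2.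
by apply: le_trans (lerD h1 h3) _; rewrite le_eqVlt; apply/predU1P; left; rewrite exprS /D; ring.
Qed.

(** * Product identities and resolvents of skew-adjoint elements *)

Lemma cmulBr x y z : x ** (y - z) = x ** y - x ** z.
Proof. by apply: (addIr (x ** z)); rewrite -cmulDr !subrK. Qed.

Lemma cmulBl x y z : (x - y) ** z = x ** z - y ** z.
Proof. by apply: (addIr (y ** z)); rewrite -cmulDl !subrK. Qed.

Lemma cmulr0 x : x ** 0 = 0.
Proof. by have := cmulBr x 0 0; rewrite !subrr. Qed.

Lemma cmul0r x : 0 ** x = 0.
Proof. by have := cmulBl 0 0 x; rewrite !subrr. Qed.

Lemma cmulrN x y : x ** - y = - (x ** y).
Proof. by rewrite -sub0r cmulBr cmulr0 sub0r. Qed.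

Lemma cmulNr x y : - x ** y = - (x ** y).
Proof. by rewrite -sub0r cmulBl cmul0r sub0r. Qed.

Lemma cadjN x : cadj (- x) = - cadj x.
Proof.
by rewrite -scaleN1r cadjZ rmorphN rmorph1 scaleN1r.
Qed.

(** In the expansion given by the C*-identity the cross terms cancel, as [k] is skew-adjoint;
    besides [cadj y ** y] only a term in [t ^+ 2] remains. *)
Lemma rnorm_skew_sqr k t y : cadj k = - k -> 0 <= t ->
  (1 - t ^+ 2 * rnorm k ^+ 2) * rnorm y ^+ 2
    <= rnorm (y + t%:C *: (k ** y)) ^+ 2.
Proof.
move=> kN t0; rewrite -[leRHS]rnorm_adj_mul.
have -> : cadj (y + t%:C *: (k ** y)) ** (y + t%:C *: (k ** y)) =
    cadj y ** y - (t ^+ 2)%:C *: (cadj y ** (k ** (k ** y))).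
  have conj_t : Num.conj (t%:C : R[i]) = t%:C by exact: conjc_real.
  rewrite cadjD cadjZ cadjM kN conj_t.
  rewrite cmulDl !cmulDr !cmulZl !cmulZr.
  rewrite cmulrN !cmulNr !scalerN !cmulA scalerA addrA addrK.
  by rewrite -rmorphM.
have tri u v : rnorm u - rnorm v <= rnorm (u - v).
  by rewrite lerBlDr; have := rnormD (u - v) v; rewrite subrK.
apply: le_trans (tri _ _); rewrite rnorm_adj_mul rnormZ ?sqr_ge0//.
have : rnorm (cadj y ** (k ** (k ** y))) <= rnorm k ^+ 2 * rnorm y ^+ 2.
  apply: le_trans (rnormM _ _) _; rewrite rnorm_adj.
  have := ler_wpM2l (rnorm_ge0 k) (rnormM k y) => /(le_trans (rnormM _ _)).
  move=> /(ler_wpM2l (rnorm_ge0 y)) /le_trans; apply.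
  by rewrite le_eqVlt; apply/predU1P; left; ring.
move=> /(ler_wpM2l (sqr_ge0 t)); lra.
Qed.

(* By convexity in [t], a decrease of the norm at one [t] would be linear near
   [0], whereas [rnorm_skew_sqr] only allows a quadratic one. *)
Lemma skew_dissipative k t y : cadj k = - k -> 0 <= t ->
  rnorm y <= rnorm (y + t%:C *: (k ** y)).
Proof.
move=> kN t0; set w := y + _; rewrite leNgt; apply/negP => wy.
pose d := rnorm y - rnorm w; have d0 : 0 < d by rewrite subr_gt0.
have y0 : 0 < rnorm y by apply: le_lt_trans wy; apply: rnorm_ge0.
(* For [h = 2^-n], comparing squares at parameter [h * t] gives
   [2 * h * d * rnorm y <= h ^+ 2 * X]. *)
pose X := d ^+ 2 + (t * rnorm k * rnorm y) ^+ 2.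
suff : 2 * (d * rnorm y) <= 0 by have := mulr_gt0 d0 y0; lra.
apply: (@le0_geometric _ 2^-1 X); [lra|lra|move=> n].
set h := 2^-1 ^+ n; have h0 : 0 < h by rewrite exprn_gt0.
have h1 : h <= 1 by rewrite exprn_ile1// ?invr_ge0 ?invf_le1 ?ler1n.
have up : rnorm (y + (h * t)%:C *: (k ** y)) <= rnorm y - h * d.
  have -> : y + (h * t)%:C *: (k ** y) = (1 - h)%:C *: y + h%:C *: w.
    rewrite /w scalerDr scalerA -rmorphM addrA -scalerDl -rmorphD subrK.
    by rewrite rmorph1 scale1r.
  apply: le_trans (rnormD _ _) _; rewrite !rnormZ ?(ltW h0) ?subr_ge0//.
  by rewrite /d; lra.
have := @rnorm_skew_sqr k (h * t) y kN (mulr_ge0 (ltW h0) t0).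
move=> /le_trans /(_ (lerXn2r 2 (rnorm_ge0 _) (le_trans (rnorm_ge0 _) up) up)) H.
rewrite -(ler_pM2l h0); move: H; rewrite /X; nra.
Qed.

Lemma scale_cmul_lin (k x y : A) (t : R[i]) :
  x - y + t *: (k ** (x - y)) = (x + t *: (k ** x)) - (y + t *: (k ** y)).
Proof. by rewrite cmulBr scalerBr opprD addrACA. Qed.

(** A fixed point solves the equation for a small parameter [s]; by dissipativity the solution map
    is nonexpansive, which allows continuation to [t]. *)
Lemma skew_resolvent k t y : cadj k = - k -> 0 < t ->
  exists x, x + t%:C *: (k ** x) = y.
Proof.
move=> kN t0; have k0 := rnorm_ge0 k.
(* Ensures [s * rnorm k <= 2^-1]; the [+ 1] covers [k = 0]. *)
pose s0 := (2 * (rnorm k + 1))^-1.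
have s00 : 0 < s0 by rewrite invr_gt0; lra.
pose s := Num.min t s0.
have s_gt0 : 0 < s by rewrite lt_min t0 s00.
have st : s <= t by rewrite ge_min lexx.
have sk : s * rnorm k <= 2^-1.
  have : s <= s0 by rewrite ge_min lexx orbT.
  move=> /(ler_wpM2r k0) /le_trans; apply.
  by rewrite /s0 invfM -mulrA ler_piMr// mulrC ler_pdivrMr; lra.
have /choice[r rE] v : exists x, x + s%:C *: (k ** x) = v.
  have [|||x xE] := @contraction_fixpoint (fun x => v - s%:C *: (k ** x)) 2^-1.
  - by lra.
  - by lra.
  - move=> x x'; rewrite opprB addrC addrA subrK -scalerBr -cmulBr.
    rewrite rnormZ ?(ltW s_gt0)// rnorm_distrC.
    have := ler_wpM2l (ltW s_gt0) (rnormM k (x' - x)) => /le_trans; apply.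
    by rewrite mulrA ler_wpM2r// rnorm_ge0.
  - by exists x; rewrite {1}xE subrK.
have rB v w : rnorm (r v - r w) <= rnorm (v - w).
  apply: le_trans (skew_dissipative _ kN (ltW s_gt0)) _.
  by rewrite scale_cmul_lin !rE.
(* Since [1 + t k = (t/s) (1 + s k) - (t/s - 1)], one further contraction leads
   from the small parameter [s] to [t]. *)
have st0 : 0 < s / t by rewrite divr_gt0.
have st1 : s / t <= 1 by rewrite ler_pdivrMr// mul1r.
have [|||x xE] := @contraction_fixpoint
    (fun x => r ((s / t)%:C *: y + (1 - s / t)%:C *: x)) (1 - s / t).
- by lra.
- by lra.
- move=> x x'; apply: le_trans (rB _ _) _.
  by rewrite opprD addrACA subrr add0r -scalerBr rnormZ// subr_ge0.
exists x; have := rE ((s / t)%:C *: y + (1 - s / t)%:C *: x).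
rewrite -xE rmorphB rmorph1 scalerBl scale1r addrCA => /addrI.
have -> : s%:C = (s / t)%:C * t%:C :> R[i] by rewrite -rmorphM divfK// gt_eqF.
rewrite -scalerA -scalerBr => /scalerI -> //; first by rewrite addrC subrK.
by rewrite -(rmorph0 (real_complex R)) (inj_eq (@complexI R)) gt_eqF.
Qed.

(** For want of a unit the hypothesis is tested on [cadj z]: by the C*-identity,
    [rnorm (z ** cadj z)] is [rnorm z ^+ 2]. *)
Lemma rnorm_le2 z : (forall y, rnorm (y - z ** y) <= rnorm y) -> rnorm z <= 2.
Proof.
move=> z1; have : rnorm (z ** cadj z) <= 2 * rnorm (cadj z).
  have -> : z ** cadj z = cadj z - (cadj z - z ** cadj z) by rewrite subKr.
  by have := z1 (cadj z); have := rnormB (cadj z) (cadj z - z ** cadj z); lra.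
rewrite -{1}(cadjK z) rnorm_adj_mul rnorm_adj expr2.
have := rnorm_ge0 z; rewrite le0r => /predU1P[->|z0]; first by rewrite ler0n.
by rewrite ler_pM2r.
Qed.

(** With [z = t k (1 + t k)^-1], formally [1 - z] is the resolvent and [k - z k = t^-1 z], of norm
    at most [2 / t]. The last clause will make all such [z] commute with each other. *)
Lemma skew_approx_unit k e : cadj k = - k -> 0 < e -> exists z,
  [/\ forall y, rnorm (y - z ** y) <= rnorm y,
      rnorm (k - z ** k) <= e &
      forall w, w ** k = k ** w -> w ** z = z ** w].
Proof.
move=> kN e0; pose t := 2 / e; have t0 : 0 < t by rewrite divr_gt0.
have tC0 : t%:C != 0 :> R[i].
  by rewrite -(rmorph0 (real_complex R)) (inj_eq (@complexI R)) gt_eqF.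
have [z zE] := skew_resolvent (t%:C *: k) kN t0.
have inj y : y + t%:C *: (k ** y) = 0 -> y = 0.
  move=> y0; apply: rnorm_eq0; apply: le_trans (skew_dissipative y kN (ltW t0)) _.
  by rewrite y0 rnorm0.
(* [1 + t k] maps both [w ** z] and [z ** w] to [t k w]. *)
have zC w : w ** k = k ** w -> w ** z = z ** w.
  move=> wk; apply/subr0_eq/inj; rewrite scale_cmul_lin.
  rewrite !cmulA -wk -(cmulA w) -(cmulZr _ w) -cmulDr zE.
  by rewrite -cmulZl -cmulDl zE cmulZl cmulZr wk subrr.
(* [1 + t k] maps [y - z ** y] to [y]. *)
have z1 y : rnorm (y - z ** y) <= rnorm y.
  apply: le_trans (skew_dissipative _ kN (ltW t0)) _.
  by rewrite scale_cmul_lin cmulA -(cmulZl _ (k ** z)) -cmulDl zE cmulZl addrK.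
exists z; split => //.
have -> : k - z ** k = (t^-1)%:C *: z.
  apply: (scalerI tC0); rewrite scalerBr scalerA -rmorphM divff ?gt_eqF//.
  rewrite rmorph1 scale1r -(zC k)//.
  by rewrite -{1}zE addrK.
rewrite rnormZ ?invr_ge0 ?(ltW t0)// /t invf_div mulrAC ler_pdivrMr//.
by rewrite ler_wpM2l ?(ltW e0)// rnorm_le2.
Qed.

(** * Cohen-type factorization with dyadic weights *)

Section Factorization.
Variable z : nat -> A.
Hypothesis zC : forall i j, z i ** z j = z j ** z i.
Hypothesis z1 : forall n y, rnorm (y - z n ** y) <= rnorm y.
Let h : R := 2^-1.

Let h0 : 0 < h. Proof. by rewrite invr_gt0. Qed.
Let hS n : h ^+ n = h ^+ n.+1 + h ^+ n.+1.
Proof. by rewrite exprS /h; field. Qed.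
Let hn0 n : 0 < h ^+ n. Proof. by rewrite exprn_gt0. Qed.
Let hn1 n : h ^+ n <= 1.
Proof. by rewrite exprn_ile1// ?invr_ge0 ?invf_le1 ?ler1n. Qed.

Definition dyadic_sum n : A := \sum_(j < n) (h ^+ j.+1)%:C *: z j.

(* Approximates multiplication by the limit of [dyadic_sum], but is invertible,
   with inverse of norm at most [2^n]. *)
Definition dyadic_op n y := (h ^+ n)%:C *: y + dyadic_sum n ** y.

Lemma dyadic_sumS n :
  dyadic_sum n.+1 = dyadic_sum n + (h ^+ n.+1)%:C *: z n.
Proof. by rewrite /dyadic_sum big_ord_recr. Qed.

Lemma dyadic_sumC n m : dyadic_sum n ** z m = z m ** dyadic_sum n.
Proof.
elim: n => [|n IH]; first by rewrite /dyadic_sum big_ord0 cmulr0 cmul0r.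
by rewrite dyadic_sumS cmulDl cmulDr IH cmulZl cmulZr zC.
Qed.

Lemma dyadic_opB n x y :
  dyadic_op n (x - y) = dyadic_op n x - dyadic_op n y.
Proof. by rewrite /dyadic_op scalerBr cmulBr opprD addrACA. Qed.

Lemma dyadic_opS n y :
  dyadic_op n y - dyadic_op n.+1 y = (h ^+ n.+1)%:C *: (y - z n ** y).
Proof.
rewrite /dyadic_op dyadic_sumS hS rmorphD scalerDl cmulDl cmulZl scalerBr.
by set u := _ *: y; rewrite -(addrA u) (addrA u _ (_ *: _)) addrKA.
Qed.

(** [dyadic_op n] is a convex combination of the identity, with weight [h ^+ n], and of
    multiplications by the [z j], where each [1 - z j] is nonexpansive. *)
Lemma dyadic_op_near1 n y :
  rnorm (y - dyadic_op n y) <= (1 - h ^+ n) * rnorm y.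
Proof.
elim: n => [|n IH].
  rewrite /dyadic_op /dyadic_sum big_ord0 cmul0r expr0 rmorph1 scale1r addr0.
  by rewrite !subrr rnorm0 mul0r.
rewrite -(subrKA (dyadic_op n y)) dyadic_opS; apply: le_trans (rnormD _ _) _.
rewrite rnormZ ?(ltW (hn0 _))//; move: IH; rewrite (hS n).
have := ler_wpM2l (ltW (hn0 n.+1)) (z1 n y); lra.
Qed.

Lemma dyadic_op_lower n y : h ^+ n * rnorm y <= rnorm (dyadic_op n y).
Proof.
have := rnormD (dyadic_op n y) (y - dyadic_op n y); rewrite addrC subrK.
have := dyadic_op_near1 n y; lra.
Qed.

Lemma dyadic_op_surj n x : exists c, dyadic_op n c = x.
Proof.
have [|||c cE] := @contraction_fixpoint (fun c => x + (c - dyadic_op n c)) (1 - h ^+ n).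
- by rewrite subr_ge0.
- by rewrite gtrBl.
- move=> c c'; apply: le_trans (dyadic_op_near1 n _).
  by rewrite /= dyadic_opB [- (x + _)]opprD addrACA subrr add0r !opprD addrACA.
- exists c; move/eqP: cE; rewrite addrCA -subr_eq0 opprD addrA subrr sub0r.
  by rewrite opprB subr_eq0 => /eqP.
Qed.

Lemma dyadic_opM n m y : dyadic_op n (z m ** y) = z m ** dyadic_op n y.
Proof. by rewrite /dyadic_op cmulDr cmulZr !cmulA dyadic_sumC. Qed.

(** All [m] at once: each division by the limit of [dyadic_sum] costs a factor [2^n], so a fixed
    exponent would be used up by iteration. *)
Definition fast_approx x :=
  forall m, exists C, forall n, rnorm (x - z n ** x) <= C * h ^+ (m * n).

Lemma dyadic_sum_cvg :
  exists b, forall n, rnorm (dyadic_sum n - b) <= 2 * h ^+ n.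
Proof.
have [|||b bE] := @geometric_cvg dyadic_sum h 1.
- exact: ltW.
- by rewrite /h; lra.
- move=> n; rewrite dyadic_sumS [dyadic_sum n + _]addrC addrK rnormZ ?(ltW (hn0 _))// exprSr.
  by rewrite mul1r -mulrA ler_piMr ?(ltW (hn0 _))// /h; have := rnorm_le2 (z1 n); lra.
exists b => n; apply: le_trans (bE n) _.
have -> : 1 - h = h by rewrite /h; field.
by rewrite div1r invrK.
Qed.

(** The quotients [c n] of [x] by [dyadic_op n] have increments bounded by
    [rnorm (c n - z n ** c n)], itself at most [2^n] times the error for [x]; their limit is the
    required factor. *)
Lemma cohen_step b : (forall n, rnorm (dyadic_sum n - b) <= 2 * h ^+ n) ->
  forall x, fast_approx x -> exists2 c, x = b ** c & fast_approx c.
Proof.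
move=> bE x xfast.
have /choice[c cE] n : exists c, dyadic_op n c = x by apply: dyadic_op_surj.
have c_near n : h ^+ n * rnorm (c n - z n ** c n) <= rnorm (x - z n ** x).
  by apply: le_trans (dyadic_op_lower _ _) _; rewrite dyadic_opB dyadic_opM cE.
have c_step n : rnorm (c n.+1 - c n) <= rnorm (c n - z n ** c n).
  rewrite -(ler_pM2l (hn0 n.+1)); apply: le_trans (dyadic_op_lower _ _) _.
  by rewrite dyadic_opB cE -{1}(cE n) dyadic_opS rnormZ ?(ltW (hn0 _)).
have c_fast m : exists2 C, 0 <= C &
    forall n, rnorm (c n - z n ** c n) <= C * (h ^+ m.+1) ^+ n.
  (* One factor [h ^+ n] is lost in [c_near]; another keeps the ratio [h ^+ m.+1] below 1 when
     [m = 0]. *)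
  have [C CE] := xfast m.+2; exists C.
    by have := CE 0%N; rewrite muln0 expr0 mulr1; apply: le_trans (rnorm_ge0 _).
  move=> n; rewrite -(ler_pM2l (hn0 n)); apply: le_trans (c_near n) _.
  apply: le_trans (CE n) _; rewrite mulrCA -exprM -exprD -mulSn.
  by [].
have c_cvg m : exists l C, 0 <= C /\
    forall n, rnorm (c n - l) <= C * (h ^+ m.+1) ^+ n.
  have [C C0 CE] := c_fast m.
  have [|||l lE] := @geometric_cvg c (h ^+ m.+1) C.
  - exact: ltW.
  - by rewrite exprn_ilt1 ?(ltW h0)// /h; lra.
  - by move=> n; apply: le_trans (c_step n) (CE n).
  exists l, (C / (1 - h ^+ m.+1)); split => //.
  by rewrite divr_ge0 ?subr_ge0.
have [l [C0 [C0_ge0 lE]]] := c_cvg 0%N.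
have h1 : h < 1 by rewrite /h; lra.
exists l.
  apply/subr0_eq/rnorm_eq0.
  apply: (@le0_geometric _ h (rnorm l + C0 + 2 * (rnorm l + C0) + rnorm b * C0)) => //.
    exact: ltW.
  move=> n.
  have cl : rnorm (c n) <= rnorm l + C0.
    have := rnormD (c n - l) l; rewrite subrK => /le_trans; apply.
    rewrite addrC lerD2l; apply: le_trans (lE n) _.
    by rewrite expr1 ler_piMr.
  (* Each of the three terms is of order [h ^+ n]. *)
  have -> : x - b ** l = (h ^+ n)%:C *: c n
      + ((dyadic_sum n - b) ** c n + b ** (c n - l)).
    by rewrite -(cE n) /dyadic_op cmulBl cmulBr subrKA addrA.
  apply: le_trans (rnormD _ _) _; rewrite rnormZ ?(ltW (hn0 _))//.
  have t1 := ler_wpM2l (ltW (hn0 n)) cl.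
  have t2 : rnorm ((dyadic_sum n - b) ** c n) <= 2 * h ^+ n * (rnorm l + C0).
    by apply: le_trans (rnormM _ _) _; apply: ler_pM (rnorm_ge0 _) (rnorm_ge0 _) (bE n) cl.
  have t3 := le_trans (rnormM b (c n - l)) (ler_wpM2l (rnorm_ge0 b) (lE n)).
  rewrite expr1 in t3.
  have := rnormD ((dyadic_sum n - b) ** c n) (b ** (c n - l)); lra.
move=> m.
have [l' [C' [C'_ge0 lE']]] := c_cvg m.
(* [c_cvg] yields a limit for each [m]; uniqueness identifies it with [l]. *)
have ll' : l = l'.
  apply/subr0_eq/rnorm_eq0; apply: (@le0_geometric _ h (C0 + C')) => //.
    exact: ltW.
  move=> n; rewrite -(subrKA (c n)); apply: le_trans (rnormD _ _) _.
  rewrite mulrDl rnorm_distrC lerD//.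
  apply: le_trans (lE' n) _; rewrite ler_wpM2l// -exprM mulSn exprD.
  by rewrite ler_piMr ?(ltW (hn0 _)).
have [C C_ge0 CE] := c_fast m.
exists (C + C') => n.
have -> : l - z n ** l = (c n - z n ** c n) - ((c n - l) - z n ** (c n - l)).
  by rewrite cmulBr (opprD (z n ** c n)) [c n - l + _]addrACA -(opprD l) subKr.
apply: le_trans (rnormB _ _) _; rewrite mulrDl.
have hmn : (h ^+ m.+1) ^+ n <= h ^+ (m * n).
  by rewrite -exprM mulSn addnC exprD ler_piMr ?(ltW (hn0 _)).
apply: lerD; first by apply: le_trans (CE n) _; rewrite ler_wpM2l.
apply: le_trans (z1 _ _) _; rewrite ll'; apply: le_trans (lE' n) _.
by rewrite ler_wpM2l.
Qed.

End Factorization.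

Lemma skew_factor k : cadj k = - k ->
  exists b, forall n, exists y, k = iter n (cmul b) y.
Proof.
move=> kN; pose h : R := 2^-1; have h0 : 0 < h by rewrite invr_gt0.
(* [2^-(n^2)] beats every [2^-(m n)] up to the constant [2^(m^2)], since [m n <= m^2 + n^2]. *)
have /choice[z zE] n := skew_approx_unit kN (exprn_gt0 (n * n) h0).
have z1 n y : rnorm (y - z n ** y) <= rnorm y by case: (zE n).
have zk n : z n ** k = k ** z n by have [_ _ ->] := zE n.
have zC i j : z i ** z j = z j ** z i by have [_ _ ->] := zE j.
have k_fast : fast_approx z k.
  move=> m; exists (h ^+ (m * m))^-1 => n; have [_ zn _] := zE n.
  apply: le_trans zn _; rewrite ler_pdivlMl ?exprn_gt0// -exprD.
  apply: ler_wiXn2l; [exact: ltW|by rewrite /h; lra|nia].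
have [b bE] := dyadic_sum_cvg z1; exists b => n.
suff [y -> _] : exists2 y, k = iter n (cmul b) y & fast_approx z y by exists y.
elim: n => [|n [y kE /(cohen_step zC z1 bE)[c yE c_fast]]]; first by exists k.
by exists c => //; rewrite iterSr -yE.
Qed.

Lemma iter_cmul b n x y : iter n (cmul b) x ** y = iter n (cmul b) (x ** y).
Proof. by elim: n => //= n IH; rewrite -cmulA IH. Qed.

(** The Cartesian decomposition, its self-adjoint part rotated by ['i] to become skew-adjoint. *)
Lemma skew_decomp x : exists k1 k2 (c1 c2 : R[i]),
  [/\ cadj k1 = - k1, cadj k2 = - k2 & x = c1 *: k1 + c2 *: k2].
Proof.
exists (x - cadj x), ('i%C *: (x + cadj x)), 2^-1, (- 'i%C / 2); split.
- by rewrite cadjD cadjN cadjK opprB addrC.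
- rewrite cadjZ cadjD cadjK addrC -scaleNr; congr (_ *: _).
  by apply/eqP; rewrite eq_complex /= oppr0 !eqxx.
- rewrite scalerA mulrAC mulNr -expr2 sqr_i opprK mul1r -scalerDr.
  rewrite addrACA addNr addr0 scalerDr -scalerDl.
  have -> : 2^-1 + 2^-1 = 1 :> R[i] by field.
  by rewrite scale1r.
Qed.

(** * Ideals avoiding the powers of an element *)

Lemma idealN (I : set A) x : is_ideal I -> I x -> I (- x).
Proof. by move=> hI Ix; rewrite -sub0r; apply: idealB => //; apply: ideal0. Qed.

Lemma idealD (I : set A) x y : is_ideal I -> I x -> I y -> I (x + y).
Proof. by move=> hI Ix Iy; rewrite -(opprK y); apply: idealB => //; apply: idealN. Qed.

(** In the absence of a unit, [iter n (cmul b) b] encodes [b^(n+1)]. Were it in [I], so would be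
    [c *: k = b^(n+1) (c *: y)]. *)
Lemma ideal_avoids_powers (I : set A) : is_ideal I -> I <> setT ->
  exists b, forall n, ~ I (iter n (cmul b) b).
Proof.
move=> hI hproper; have [x Ix] : exists x, ~ I x.
  apply: contrapT => /forallNP IT; apply: hproper.
  by apply/seteqP; split=> // x _; apply: contrapT; apply: IT.
(* [I] need not be stable under scalars, so the coefficient stays attached to [k]. *)
have [k [c [kN Ick]]] : exists k (c : R[i]), cadj k = - k /\ ~ I (c *: k).
  have [k1 [k2 [c1 [c2 [k1N k2N xE]]]]] := skew_decomp x.
  have [I1|] := pselect (I (c1 *: k1)); last by exists k1, c1.
  exists k2, c2; split=> // I2; apply: Ix; rewrite xE; exact: idealD.
have [b bE] := skew_factor kN; exists b => n Ib; apply: Ick.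
have [y ->] := bE n.+1.
by rewrite iterSr -iter_cmul -cmulZr; apply: (idealMr hI).
Qed.

Lemma ideal_sum_is_ideal (I J : set A) : is_ideal I -> is_ideal J ->
  is_ideal [set x | exists2 i, I i & J (x - i)].
Proof.
move=> hI hJ; split.
- by exists 0; [apply: ideal0|rewrite subr0; apply: ideal0].
- move=> x y [i Ii Jx] [j Ij Jy]; exists (i - j); first exact: idealB.
  rewrite opprD addrACA -opprD; exact: idealB.
- move=> a x [i Ii Jx]; exists (a ** i); first exact: idealMl.
  by rewrite -cmulBr; apply: idealMl.
- move=> a x [i Ii Jx]; exists (i ** a); first exact: idealMr.
  by rewrite -cmulBl; apply: idealMr.
Qed.

Lemma ideal_avoiding_maximal (I M : set A) :
  is_ideal I -> (forall x, M x -> ~ I x) ->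
  exists P, [/\ is_ideal P, I `<=` P, forall x, M x -> ~ P x &
    forall Q, is_ideal Q -> P `<=` Q -> (forall x, M x -> ~ Q x) -> Q `<=` P].
Proof.
move=> hI IM.
(* Joining [I] handles the empty chain, whose union is empty and hence not an ideal. *)
pose good X := is_ideal (X `|` I) /\ forall x, M x -> ~ (X `|` I) x.
have [F Fgood Ftot|X [[hX XM] Xmax]] := @Zorn_bigcup A good.
  split; last first.
    move=> x Mx [[X FX Xx]|/(IM _ Mx)//].
    by have [_ /(_ x Mx)] := Fgood X FX; apply; left.
  have up x y : (\bigcup_(X in F) X `|` I) x -> (\bigcup_(X in F) X `|` I) y ->
      (I x /\ I y) \/ exists X, [/\ F X, (X `|` I) x & (X `|` I) y].
    move=> [[X FX Xx]|Ix] [[Y FY Yy]|Iy].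
    - have [XY|YX] := Ftot X Y FX FY; right.
        by exists Y; split=> //; left => //; apply: XY.
      by exists X; split=> //; left => //; apply: YX.
    - by right; exists X; split=> //; [left|right].
    - by right; exists Y; split=> //; [right|left].
    - by left.
  have sub X : F X -> X `|` I `<=` \bigcup_(X in F) X `|` I.
    by move=> FX x [Xx|Ix]; [left; exists X|right].
  split.
  - by right; apply: ideal0.
  - move=> x y /up /[apply] -[[Ix Iy]|[X [FX Xx Xy]]]; first by right; apply: idealB.
    by apply: (sub X FX); apply: idealB => //; have [] := Fgood X FX.
  - move=> a x Fx; have [[Ix _]|[X [FX Xx _]]] := up x x Fx Fx.
      by right; apply: idealMl.
    by apply: (sub X FX); apply: idealMl => //; have [] := Fgood X FX.
  - move=> a x Fx; have [[Ix _]|[X [FX Xx _]]] := up x x Fx Fx.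
      by right; apply: idealMr.
    by apply: (sub X FX); apply: idealMr => //; have [] := Fgood X FX.
exists (X `|` I); split=> // Q hQ XQ QM x Qx.
have QI : Q `|` I = Q by apply/setUidPl => y Iy; apply: XQ; right.
apply: contrapT => nXx; apply: (Xmax Q); last by rewrite /good QI.
by split=> [y Xy|QX]; [apply: XQ; left|apply: nXx; left; apply: QX].
Qed.

End CstarAlgebraTheory.

Theorem theoremA (R : realType) (A : cstarAlgType R) (I : set A)
    (hI : is_ideal I) (hproper : I <> setT) :
  exists J : set A, is_prime_ideal J /\ I `<=` J.
Proof.
have [b Ib] := ideal_avoids_powers hI hproper.
pose M := range (fun n => iter n (cmul b) b).
have [|P [hP IP PM Pmax]] := @ideal_avoiding_maximal R A I M hI.
  by move=> _ [n _ <-].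
(* By maximality [P + J] contains a power of [b]; [p] is its component in [P]. *)
have meets J : is_ideal J -> ~ J `<=` P ->
    exists n p, P p /\ J (iter n (cmul b) b - p).
  move=> hJ; apply: contra_notP => nJ x Jx.
  apply: (Pmax _ (ideal_sum_is_ideal hP hJ)); first 2 last.
  - by exists 0; [apply: ideal0|rewrite subr0].
  - by move=> y Py; exists y => //; rewrite subrr; apply: ideal0.
  - by move=> _ [n _ <-] [p Pp Jp]; apply: nJ; exists n, p.
exists P; split=> //; split=> // [PT|J K hJ hK JK].
  by apply: (PM b); [exists 0%N|rewrite PT].
apply: contrapT => /not_orP[/(meets J hJ)[n [p [Pp Jp]]] /(meets K hK)[m [q [Pq Kq]]]].
(* The product of [b^(n+1)] and [b^(m+1)] is [b^(n+m+2)], whence the index [(n + m).+1]. *)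
apply: (PM (iter (n + m).+1 (cmul b) b)); first by exists (n + m).+1.
rewrite -addnS iterD /= -iter_cmul.
set u := iter n _ _ in Jp *; set v := iter m _ _ in Kq *.
(* The first product lies in [JK], hence in [P]; the other two lie in [P] because [q] and [p] do. *)
have -> : u ** v = (u - p) ** (v - q) + (u ** q + p ** (v - q)).
  by rewrite cmulBl (addrC (u ** q)) subrKA -cmulDr subrK.
apply: idealD => //; last first.
  by apply: idealD => //; [apply: idealMl|apply: idealMr].
by apply: JK; exists 1%N, (fun=> u - p), (fun=> v - q); split=> //; rewrite big_ord1.
Qed.
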